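(* Let $G$ be a graph of maximum degree $\Delta$ that satisfies the private neighbor condition, that is, for every $u\in V(G)$ with $d_G(u)\geq 2$ and every $v\in N_G(u)$ there is some $w\in N_G(v)$ with $N_G(w)\cap N_G[u]=\{v\}$. Let $\delta=\min\{d_G(u): u\in V(G)\text{ and } d_G(u)\geq 2\}$. Then $G$ is good and $$\chi_{mac}(G)\leq 4e^3\cdot \Delta^{\frac{4}{\lfloor \delta/2\rfloor}},$$ where $e$ is Euler's number.
   Context: All graphs are finite, simple and undirected. For a graph $G$ and a vertex $u$, $N_G(u)$ denotes the set of neighbors of $u$, $N_G[u]=N_G(u)\cup\{u\}$, and $d_G(u)=|N_G(u)|$ is its degree. For a positive integer $k$, let $[k]=\{1,2,\ldots,k\}$. For $c:V(G)\to[k]$ define $s_c(u)=\sum_{v\in N_G(u)}c(v)$ for every $u\in V(G)$. The function $c$ is a majority additive $k$-coloring of $G$ if there is no vertex $u$ of $G$ and no integer $s$ such that $d_G(u)\geq 2$ and $s_c(v)=s$ for more than half of the neighbors $v$ of $u$. A graph $G$ is good if there do NOT exist a vertex $u\in V(G)$ and a set $R\subseteq N_G(u)$ such that $2|R|>d_G(u)>1$ and $N_G(v)=N_G(w)$ for all $v,w\in R$. (A graph is good if and only if it has a majority additive $k$-coloring for some positive integer $k$.) For a good graph $G$, the majority additive chromatic number $\chi_{mac}(G)$ is the smallest positive integer $k$ such that $G$ has a majority additive $k$-coloring. *)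

(* Defs.v *)
From mathcomp Require Import all_boot all_order all_algebra.
From mathcomp Require Import all_classical all_reals all_analysis.

Set Implicit Arguments.
Unset Strict Implicit.
Unset Printing Implicit Defensive.

Record sgraph := SGraph {
  vertex :> finType;
  adj : rel vertex;
  adj_sym : symmetric adj;
  adj_irrefl : irreflexive adj }.

Section Definitions.
Variable G : sgraph.
Implicit Types (u v w : G) (c : G -> nat) (k : nat).

Definition nbh u : {set G} := [set v | adj u v].

Definition cnbh u : {set G} := u |: nbh u.

Definition deg u : nat := #|nbh u|.

Definition max_deg : nat := \max_(u : G) deg u.

(* Minimum of the degrees that are at least 2.  All degrees are at most
   max_deg, so the default value of the big operator is harmless when such a
   degree exists.  When none exists the value is max_deg <= 1, whose half is 0;
   since x / 0 = 0, an exponent 4 / (min_deg2./2) is then 0, in agreement with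
   the convention that the minimum of the empty set is infinite. *)
Definition min_deg2 : nat := \big[minn/max_deg]_(u : G | 2 <= deg u) deg u.

Lemma min_deg2_le u : 2 <= deg u -> min_deg2 <= deg u.
Proof.
move=> u2; rewrite /min_deg2; have := mem_index_enum u.
elim: (index_enum _) => // v s IHs; rewrite inE big_cons => /predU1P[<-|/IHs le_s].
  by rewrite u2 geq_minl.
by case: ifP => // _; rewrite geq_min le_s orbT.
Qed.

Lemma min_deg2_attained u0 : 2 <= deg u0 ->
  exists2 u, 2 <= deg u & min_deg2 = deg u.
Proof.
move=> u02; case: (@arg_minnP _ u0 (fun u => 1 < deg u) deg u02) => u u2 umin.
exists u => //; apply/eqP; rewrite eqn_leq min_deg2_le //=.
rewrite /min_deg2; elim/big_ind: _ => //.
- exact: (@leq_bigmax _ deg u).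
- by move=> x y ux uy; rewrite leq_min ux.
Qed.

Definition nbsum c u : nat := \sum_(v in nbh u) c v.

Definition majority_additive_coloring k c : Prop :=
  (forall u, 1 <= c u <= k) /\
  ~ exists (u : G) (s : int),
      2 <= deg u /\ deg u < 2 * #|[set v in nbh u | Posz (nbsum c v) == s]|.

Definition majority_additive_colorable k : Prop :=
  exists c : G -> nat, majority_additive_coloring k c.

Definition good : Prop :=
  ~ exists (u : G) (R : {set G}),
      [/\ R \subset nbh u, 1 < deg u < 2 * #|R| &
          {in R &, forall v w, nbh v = nbh w}].

Definition private_neighbor_condition : Prop :=
  forall u v, 2 <= deg u -> v \in nbh u ->
  exists2 w, w \in nbh v & nbh w :&: cnbh u = [set v].

Lemma sum_pow2_inj n (A B : {set 'I_n}) :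
  \sum_(i in A) 2 ^ i = \sum_(i in B) 2 ^ i -> A = B.
Proof.
elim: n A B => [|n IHn] A B.
  by move=> _; apply/setP => -[].
have sumE (C : {set 'I_n.+1}) : \sum_(i in C) 2 ^ i =
    (ord0 \in C) + (\sum_(i in lift ord0 @^-1: C) 2 ^ i).*2.
  rewrite big_mkcond big_ord_recl /=; congr (_ + _).
  rewrite -mul2n big_distrr [RHS]big_mkcond; apply: eq_bigr => i _.
  by rewrite inE /bump add1n expnS.
rewrite !sumE => eqAB.
have eq0 : (ord0 \in A) = (ord0 \in B).
  by have := congr1 odd eqAB; rewrite !oddD !odd_double !addbF !oddb.
have /IHn/setP eqS : \sum_(i in lift ord0 @^-1: A) 2 ^ i
                   = \sum_(i in lift ord0 @^-1: B) 2 ^ i.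
  by move: eqAB; rewrite eq0 => /addnI/double_inj.
apply/setP => i; case: (unliftP ord0 i) => [j|] -> //.
by have := eqS j; rewrite !inE.
Qed.

Lemma good_colorable : good ->
  exists k, `[< 0 < k /\ majority_additive_colorable k >].
Proof.
move=> gG; pose c u := 2 ^ (enum_rank u).
exists (2 ^ #|G|); apply/asboolP; split; first by rewrite expn_gt0.
exists c; split=> [u|[u [s [u2 us]]]].
  by rewrite /c expn_gt0 /= leq_exp2l //; apply/ltnW/ltn_ord.
apply: gG; exists u, [set v in nbh u | Posz (nbsum c v) == s]; split.
- by apply/fintype.subsetP => v; rewrite inE => /andP[].
- by rewrite u2.
have cE v : nbsum c v = \sum_(i in enum_rank @: nbh v) 2 ^ i.
  by rewrite big_imset //= => x y _ _; apply: enum_rank_inj.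
move=> v w; rewrite !inE => /andP[_ /eqP vs] /andP[_ /eqP ws].
apply: (imset_inj enum_rank_inj); apply: sum_pow2_inj.
by rewrite -!cE; move: vs; rewrite -ws => -[].
Qed.

Definition chi_mac (gG : good) : nat := ex_minn (good_colorable gG).

Lemma chi_macP (gG : good) :
  [/\ 0 < chi_mac gG, majority_additive_colorable (chi_mac gG) &
      forall k, 0 < k -> majority_additive_colorable k -> chi_mac gG <= k].
Proof.
rewrite /chi_mac; case: ex_minnP => m /asboolP[m0 mc] mmin; split=> // k k0 kc.
by apply: mmin; apply/asboolP.
Qed.

End Definitions.

(* Main.v *)
Require Import Defs.
From mathcomp Require Import all_boot all_order all_algebra.
From mathcomp Require Import all_classical all_reals all_analysis.
From mathcomp Require Import zify lra.
Import Order.TTheory GRing.Theory Num.Theory.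

(* Color the vertices uniformly at random with k colors.  Fix u and a set R of
   more than half of its neighbors; the private neighbors w_v of the v in R are
   pairwise distinct, and w_v contributes to the sum at v only.  Hence, once the
   sum at one vertex of R and all colors but those of the other |R| - 1 private
   neighbors are known, at most one choice of these |R| - 1 colors makes all the
   sums on R equal.  So, given any event that does not depend on the colors of
   the private neighbors at u, the conditional probability that u is bad is at
   most 2^d(u) / k^(floor (d(u)/2)).  Only Delta^3 vertices have a bad event that
   depends on a private neighbor at u, and the local lemma applies. *)

(** * The symmetric local lemma, by counting *)

Section LocalLemma.
Set Implicit Arguments.
Unset Strict Implicit.
Local Open Scope nat_scope.
Variables (T I : finType) (E : I -> {set T}).
Implicit Types (S : {set I}) (t : T).

Definition avoid S : {set T} := ~: \bigcup_(i in S) E i.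

Lemma avoidP S t : reflect {in S, forall i, t \notin E i} (t \in avoid S).
Proof.
rewrite finset.inE; apply: (iffP negP) => [nE i iS|nE /bigcupP[i iS]].
  by apply/negP => tE; apply: nE; apply/bigcupP; exists i.
exact/negP/nE.
Qed.

Lemma avoidS S1 S2 : S1 \subset S2 -> avoid S2 \subset avoid S1.
Proof.
move=> s12; apply/fintype.subsetP => t /avoidP tS2.
by apply/avoidP => i /(fintype.subsetP s12); apply: tS2.
Qed.

Lemma card_avoidU S1 S2 :
  #|avoid S2| <= #|avoid (S1 :|: S2)| + \sum_(i in S1) #|E i :&: avoid S2|.
Proof.
apply: leq_trans (_ : #|avoid (S1 :|: S2) :|:
    \bigcup_(i in S1) (E i :&: avoid S2)| <= _).
  apply/subset_leq_card/fintype.subsetP => t tS2; rewrite finset.inE.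
  case: (boolP (t \in avoid (S1 :|: S2))) => //= nS12.
  apply/bigcupP; apply: contrapT => nE; move/negP: nS12; apply.
  apply/avoidP => i; rewrite finset.inE => /orP[iS1|]; last exact/avoidP.
  by apply/negP => tE; apply: nE; exists i => //; rewrite finset.inE tE.
apply: leq_trans (leq_card_setU _ _) _; rewrite leq_add2l.
elim/big_rec2: _ => [|i m A _ le_Am]; first by rewrite cards0.
by apply: leq_trans (leq_card_setU _ _) _; rewrite leq_add2l.
Qed.

(* Symmetric local lemma.  With conditional probabilities bounded by 1 / (2 D),
   the union bound over the at most D dependent events leaves at least half of
   the points, so no product estimate is needed. *)
Lemma local_lemma D : 0 < D -> 0 < #|T| ->
  (forall i, exists2 N : {set I}, #|N| <= D &
     forall S, [disjoint N & S] ->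
       4 * D * #|E i :&: avoid S| <= #|avoid S|) ->
  exists t, forall i, t \notin E i.
Proof.
move=> D0 T0 indepE.
have cond n S i : #|S| <= n -> 2 * D * #|E i :&: avoid S| <= #|avoid S|.
  elim: n S i => [|n IHn] S i leSn; have [N leND /(_ (S :\: N))] := indepE i.
    move: leSn; rewrite leqn0 cards_eq0 => /eqP->.
    rewrite finset.set0D; have -> : [disjoint N & finset.set0].
      by rewrite -setI_eq0 finset.setI0.
    by move=> /(_ isT); lia.
  have -> : [disjoint N & S :\: N].
    by rewrite -setI_eq0; apply/eqP/setP => x; rewrite !finset.inE; case: (x \in N).
  move=> /(_ isT) E_S2.
  (* If [S] meets [N], then [S :\: N] is smaller than [S] and the induction hypothesis applies to
     it: the at most [D] events of [S :&: N] cover at most half of [avoid (S :\: N)], so the factor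
     4 drops to 2. *)
  have [S1_0|S1_n0] := eqVneq (S :&: N) finset.set0.
    suff S2E : S :\: N = S by rewrite S2E in E_S2; lia.
    by rewrite -[RHS](finset.setID S N) S1_0 finset.set0U.
  have ltS2 : #|S :\: N| <= n.
    by move: S1_n0 leSn; rewrite -cards_eq0 -(cardsID N S); lia.
  have := card_avoidU (S :&: N) (S :\: N); rewrite finset.setID => leS2.
  have : 2 * D * \sum_(j in S :&: N) #|E j :&: avoid (S :\: N)|
      <= D * #|avoid (S :\: N)|.
    rewrite big_distrr /=; apply: leq_trans (_ : #|S :&: N| * _ <= _).
      by rewrite -sum_nat_const; apply: leq_sum => j _; apply: IHn ltS2.
    rewrite leq_mul2r; apply/orP; right; apply: leq_trans leND.
    exact/subset_leq_card/finset.subsetIr.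
  rewrite mulnAC mulnC leq_pmul2l // => leS1.
  have : #|E i :&: avoid S| <= #|E i :&: avoid (S :\: N)|.
    by apply/subset_leq_card/finset.setIS/avoidS/finset.subsetDl.
  move=> /(leq_mul (leqnn (4 * D))); lia.
(* By [cond], each further event removes at most half of what the previous ones leave. *)
have avoid_gt0 n S : #|S| <= n -> 0 < #|avoid S|.
  elim: n S => [|n IHn] S leSn.
    move: leSn; rewrite leqn0 cards_eq0 => /eqP->.
    by rewrite /avoid big_set0 finset.setC0 cardsT.
  have [->|[i iS]] := set_0Vmem S; first by apply: IHn; rewrite cards0.
  have ltSi : #|S :\ i| <= n by move: leSn; rewrite (cardsD1 i S) iS.
  have := card_avoidU [set i] (S :\ i); rewrite finset.setD1K // big_set1.
  have := cond _ _ i ltSi; have := IHn _ ltSi.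
  have : #|E i :&: avoid (S :\ i)| <= D * #|E i :&: avoid (S :\ i)|.
    by rewrite leq_pmull.
  lia.
have /card_gt0P[t /avoidP tT] := avoid_gt0 _ [set: I] (leqnn _).
by exists t => i; apply: tT.
Qed.
End LocalLemma.

(** * Counting functions determined off a set *)

Section Counting.
Set Implicit Arguments.
Unset Strict Implicit.
Local Open Scope nat_scope.

(** Overwrite a member of [A :&: B] on [W] by arbitrary values. The result stays in [B]; on [W] it
    shows the new values, and off [W] it still determines the original member. *)
Lemma card_determined_off (V C : finType) (W : {set V})
    (A B : {set {ffun V -> C}}) :
  (forall f g : {ffun V -> C}, f \in B -> {in ~: W, f =1 g} -> g \in B) ->
  {in A &, forall f g : {ffun V -> C}, {in ~: W, f =1 g} -> f = g} ->
  #|C| ^ #|W| * #|A :&: B| <= #|B|.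
Proof.
move=> Bclosed Adet.
have [->|[f0 f0AB]] := set_0Vmem (A :&: B); first by rewrite cards0 muln0.
(* If [C] is empty, the existence of [f0] forces [W] to be empty, and the factor is 0 ^ 0 = 1. *)
have [C0|] := posnP #|C|.
  have [->|[w _]] := set_0Vmem W.
    by rewrite cards0 mul1n subset_leq_card // finset.subsetIr.
  by have := fintype0 (f0 w) C0.
case/card_gt0P => c0 _.
pose over (p : {ffun V -> C} * {ffun V -> C}) : {ffun V -> C} :=
  [ffun x => if x \in W then p.1 x else p.2 x].
(* Fixing the value [c0] off [W] leaves exactly one function per assignment on [W]. *)
pose X := [set t | t \in pffun_on c0 W [set: C]].
have cX : #|X| = #|C| ^ #|W| by rewrite cardsE card_pffun_on cardsT.
rewrite -cX -cardsX -(card_in_imset (f := over)).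
  apply/subset_leq_card/fintype.subsetP => h /imsetP[[t f]].
  rewrite 2!finset.inE /= => /andP[_ /setIP[_ fB]] ->{h}.
  by apply: Bclosed fB _ => x; rewrite finset.inE ffunE => /negbTE->.
move=> [t f] [t' f']; rewrite 2!finset.inE /= => /andP[].
rewrite finset.inE => /pffun_onP[/supportP tW _] /setIP[fA _].
rewrite 2!finset.inE /= => /andP[].
rewrite finset.inE => /pffun_onP[/supportP t'W _] /setIP[f'A _] /ffunP eq_over.
congr pair.
  apply/ffunP => x; have := eq_over x; rewrite !ffunE /=.
  by case: ifPn => // xW _; rewrite tW ?t'W.
apply: Adet => // x; rewrite finset.inE => /negbTE xW.
by have := eq_over x; rewrite !ffunE /= xW.
Qed.
End Counting.

(** * Neighborhoods and private neighbors *)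

Section Graph.
Set Implicit Arguments.
Unset Strict Implicit.
Local Open Scope nat_scope.
Variable G : sgraph.
Implicit Types (u v w : G).

Lemma nbh_sym u v : (u \in nbh v) = (v \in nbh u).
Proof. by rewrite !finset.inE adj_sym. Qed.

Lemma deg_le_max u : deg u <= max_deg G.
Proof. exact: (@leq_bigmax _ (fun u : G => deg u)). Qed.

Definition nbhs (A : {set G}) : {set G} := \bigcup_(w in A) nbh w.

Lemma card_nbhs A : #|nbhs A| <= #|A| * max_deg G.
Proof.
rewrite -sum_nat_const /nbhs; elim/big_rec2: _ => [|i m B _ le_Bm].
  by rewrite cards0.
apply: leq_trans (leq_card_setU _ _) _; exact: leq_add (deg_le_max i) le_Bm.
Qed.

(** A private neighbor of one of two vertices with equal neighborhoods is adjacent to the other as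
    well, so it is not private. *)
Lemma private_good : private_neighbor_condition G -> good G.
Proof.
move=> pnc [u [S [sSN /andP[u2 uS] eqN]]].
have /card_gt1P[v [w [vS wS vw]]] : 1 < #|S| by lia.
have [x xv /setP xP] := pnc u v u2 (fintype.subsetP sSN v vS).
have := xP w; rewrite !finset.inE (eq_sym w v) (negbTE vw).
have -> : adj x w by move: xv; rewrite (eqN v w) // finset.inE adj_sym.
by have := fintype.subsetP sSN w wS; rewrite finset.inE => ->; rewrite orbT.
Qed.

(** * Bad events of a random coloring *)

Section Coloring.
Variable k : nat.
Let color := {ffun G -> 'I_k}.
Implicit Types (f g : color).

(** The successor turns the values 0, ..., k - 1 into the colors 1, ..., k. *)
Definition csum f v := nbsum (fun w => (f w).+1) v.

Definition equal_sums (S : {set G}) : {set color} :=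
  [set f | [forall v in S, forall w in S, csum f v == csum f w]].

Lemma equal_sumsP (S : {set G}) f :
  reflect {in S &, forall v w, csum f v = csum f w} (f \in equal_sums S).
Proof.
rewrite finset.inE; apply: (iffP forall_inP) => [eqS v w vS wS|eqS v vS].
  by apply/eqP; move/forall_inP: (eqS v vS); apply.
by apply/forall_inP => w wS; apply/eqP/eqS.
Qed.

(** Ranging over sets of neighbors instead of common sums gives a union of at most [2 ^ deg u]
    events, whatever [k] is. *)
Definition bad u : {set color} :=
  if deg u < 2 then finset.set0 else
  \bigcup_(S : {set G} | (S \subset nbh u) && (deg u < 2 * #|S|)) equal_sums S.

Lemma badP u f : reflect
  (2 <= deg u /\ exists S : {set G}, [/\ S \subset nbh u, deg u < 2 * #|S| &
     f \in equal_sums S])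
  (f \in bad u).
Proof.
rewrite /bad; have [u2|u2] := ltnP (deg u) 2.
  by rewrite finset.inE; constructor; lia.
apply: (iffP bigcupP) => [[S /andP[]]|[_ [S []]]]; first by split=> //; exists S.
by exists S => //; apply/andP.
Qed.

Lemma coloring_of_avoiding f : (forall u, f \notin bad u) ->
  majority_additive_colorable G k.
Proof.
move=> fP; exists (fun u => (f u).+1); split=> [u|[u [s [u2 us]]]].
  by rewrite /= ltn_ord.
move/negP: (fP u); apply; apply/badP; split=> //.
eexists; split; [|exact: us|].
  by apply/fintype.subsetP => v; rewrite finset.inE => /andP[].
apply/equal_sumsP => v w; rewrite !finset.inE => /andP[_ /eqP vs] /andP[_ /eqP].
by rewrite -vs => -[].
Qed.

Lemma csum_eq f g v : {in nbh v, f =1 g} -> csum f v = csum g v.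
Proof. by move=> fg; apply: eq_bigr => w /fg ->. Qed.

Lemma bad_local u f g : {in nbhs (nbh u), f =1 g} -> f \in bad u -> g \in bad u.
Proof.
move=> fg /badP[u2 [S [sS uS /equal_sumsP fS]]].
apply/badP; split=> //; exists S; split=> //; apply/equal_sumsP => v w vS wS.
have fgS x : x \in S -> csum g x = csum f x.
  move=> xS; apply: csum_eq => y yx; rewrite fg //.
  by apply/bigcupP; exists x => //; apply: (fintype.subsetP sS).
by rewrite !fgS //; apply: fS.
Qed.

Lemma equal_sums_bound u (p : G -> G) (S : {set G}) (B : {set color}) :
  {in nbh u, forall v, p v \in nbh v /\ nbh (p v) :&: cnbh u = [set v]} ->
  S \subset nbh u ->
  (forall f g, f \in B -> {in ~: (p @: nbh u), f =1 g} -> g \in B) ->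
  k ^ #|S|.-1 * #|equal_sums S :&: B| <= #|B|.
Proof.
move=> pP sS Bcl.
have pS v w : v \in S -> w \in S -> p w \in nbh v -> v = w.
  move=> vS wS; rewrite nbh_sym => vpw.
  have [_ /setP/(_ v)] := pP w (fintype.subsetP sS w wS).
  rewrite finset.in_setI vpw finset.in_setU (fintype.subsetP sS v vS) orbT.
  by rewrite finset.in_set1 => /esym/eqP.
have p_inj : {in S &, injective p}.
  move=> v w vS wS pvw; apply: pS => //; rewrite -pvw.
  by have [] := pP v (fintype.subsetP sS v vS).
have [->|[r rS]] := set_0Vmem S.
  by rewrite cards0 mul1n; exact/subset_leq_card/finset.subsetIr.
have -> : #|S|.-1 = #|p @: (S :\ r)|.
  rewrite card_in_imset; first by rewrite (cardsD1 r S) rS.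
  by move=> v w /setD1P[_ vS] /setD1P[_ wS]; apply: p_inj.
rewrite -[X in X ^ _]card_ord; apply: card_determined_off.
  move=> f g fB fg; apply: Bcl fB _ => x xN; apply: fg; move: xN.
  rewrite !finset.inE; apply: contra; apply: fintype.subsetP.
  exact/imsetS/(fintype.subset_trans (finset.subsetDl _ _)).
move=> f g /equal_sumsP fS /equal_sumsP gS fg.
(* No private neighbor of another vertex of [S] is adjacent to [r], so [f] and [g] share the sum at
   [r], hence all sums on [S]. *)
have sum_r : csum f r = csum g r.
  apply: csum_eq => x xr; apply: fg; rewrite finset.inE; apply/imsetP.
  by move=> [v /setD1P[vr vS] xE]; case/eqP: vr; apply/esym/pS; rewrite -?xE.
apply/ffunP => x; have [|xW] := boolP (x \in p @: (S :\ r)); last first.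
  by apply: fg; rewrite finset.inE.
case/imsetP => v /setD1P[vr vS] ->{x}.
have [pv _] := pP v (fintype.subsetP sS v vS).
have : csum f v = csum g v by rewrite (fS v r) // sum_r; apply: gS.
(* Among the summands at [v], only the color of [p v] could differ. *)
rewrite /csum /nbsum (bigD1 (p v)) //= [RHS](bigD1 (p v)) //=.
rewrite (eq_bigr (fun w => (g w).+1)) => [/addIn[]/ord_inj //|w /andP[wv wpv]].
rewrite fg // finset.inE; apply/imsetP => -[v' /setD1P[_ v'S] wE].
by case/eqP: wpv; rewrite wE (pS v v') // -wE.
Qed.

Lemma bad_bound u (p : G -> G) (B : {set color}) : 0 < k ->
  {in nbh u, forall v, p v \in nbh v /\ nbh (p v) :&: cnbh u = [set v]} ->
  (forall f g, f \in B -> {in ~: (p @: nbh u), f =1 g} -> g \in B) ->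
  k ^ (deg u)./2 * #|bad u :&: B| <= 2 ^ deg u * #|B|.
Proof.
move=> k0 pP Bcl; rewrite /bad; case: ifP => _.
  by rewrite finset.set0I cards0 muln0.
rewrite finset.setIC big_distrr /= /deg -card_powerset -sum_nat_const.
apply: leq_trans (_ : \sum_(S in powerset (nbh u) | deg u < 2 * #|S|)
    k ^ (deg u)./2 * #|equal_sums S :&: B| <= _).
  rewrite -[leqRHS]big_distrr leq_mul2l; apply/orP; right.
  under eq_bigl do rewrite -powersetE.
  elim/big_rec2: _ => [|S m A _ le_Am]; first by rewrite cards0.
  apply: leq_trans (leq_card_setU _ _) _.
  by rewrite finset.setIC leq_add2l.
rewrite big_mkcondr /=; apply: leq_sum => S; rewrite powersetE => sS.
case: ifP => // uS; apply: leq_trans (equal_sums_bound pP sS Bcl).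
(* A set of more than d/2 vertices has size at least floor(d/2) + 1. *)
rewrite leq_mul2r leq_pexp2l ?orbT // -ltnS prednK; lia.
Qed.

Lemma colorable_of_card : private_neighbor_condition G -> 0 < k -> 0 < max_deg G ->
  (forall u, 2 <= deg u ->
     4 * max_deg G ^ 3 * 2 ^ deg u <= k ^ (deg u)./2) ->
  majority_additive_colorable G k.
Proof.
move=> pnc k0 D0 leD.
suff [f fP] : exists f, forall u, f \notin bad u by apply: coloring_of_avoiding fP.
apply: (@local_lemma _ _ _ (max_deg G ^ 3)); first by rewrite expn_gt0 D0.
  by rewrite card_ffun card_ord expn_gt0 k0.
move=> u; have [u2|u1] := ltnP 1 (deg u); last first.
  exists finset.set0 => [|S _]; first by rewrite cards0.
  by rewrite /bad ltnS u1 finset.set0I cards0 muln0.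
have [p pP] : exists p : G -> G, {in nbh u, forall v,
    p v \in nbh v /\ nbh (p v) :&: cnbh u = [set v]}.
  (* The default [v] is never reached on [nbh u], by the private neighbor condition. *)
  exists (fun v => odflt v [pick w in nbh v | nbh w :&: cnbh u == [set v]]).
  move=> v vu; case: pickP => [w /andP[wv /eqP wP]|nw] //=.
  by have [w wv wP] := pnc u v u2 vu; have := nw w; rewrite wv wP eqxx.
(* The event at [x] reads only colors two steps away from [x], so the events that read a private
   neighbor at [u] sit two steps away from [p @: nbh u]. *)
exists (nbhs (nbhs (p @: nbh u))) => [|S dNS].
  rewrite expnSr (leq_trans (card_nbhs _)) // leq_mul2r; apply/orP; right.
  rewrite expnS expn1 (leq_trans (card_nbhs _)) // leq_mul2r; apply/orP; right.
  exact: leq_trans (leq_imset_card _ _) (deg_le_max u).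
have := @bad_bound u p (avoid bad S) k0 pP.
move=> /(_ _)/wrap[f g /avoidP fS fg|le_bad].
  apply/avoidP => x xS; apply: contra (fS x xS); apply: bad_local => y yN.
  apply/esym/fg; rewrite finset.inE; apply/negP => yp.
  move: dNS; rewrite -setI_eq0 => /eqP/setP/(_ x).
  rewrite 2!finset.inE xS andbT => /bigcupP; apply.
  have /bigcupP[z zx yz] := yN; exists z; last by rewrite nbh_sym.
  by apply/bigcupP; exists y => //; rewrite nbh_sym.
have := leq_trans (leq_mul (leD u u2) (leqnn _)) le_bad.
by rewrite mulnAC [leqRHS]mulnC leq_pmul2r ?expn_gt0.
Qed.
End Coloring.
End Graph.

(** * Numerical estimates and the final bound *)

Local Open Scope ring_scope.

Theorem theorem3 (R : realType) (G : sgraph) :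
  private_neighbor_condition G ->
  exists gG : good G,
    (chi_mac gG)%:R
      <= 4 * expR 1 ^+ 3 * (max_deg G)%:R `^ (4 / (min_deg2 G)./2%:R) :> R.
Proof.
move=> pnc; exists (private_good pnc).
have [_ _ chi_le] := chi_macP (private_good pnc).
(* Squaring e^(1/2) >= 3/2 gives e >= 9/4, hence 4 e^3 >= 33. Of this, 32 serves the power estimate
   and 1 pays for rounding down to an integer [k]. *)
have e9 : 9 / 4 <= expR 1 :> R.
  have -> : expR 1 = expR 2^-1 * expR 2^-1 :> R.
    by rewrite -expRD; congr expR; lra.
  have := expR_ge1Dx (2^-1 : R); nra.
have e3 : 33 <= 4 * expR 1 ^+ 3 :> R.
  have -> : expR 1 ^+ 3 = expR 1 * (expR 1 * expR 1) :> R.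
    by rewrite !exprS expr0 mulr1.
  nra.
(* Without a vertex of degree at least 2, one color suffices and the exponent is 4 / 0 = 0. *)
have [[u0 u02]|no2] := pselect (exists u : G, (1 < deg u)%N); last first.
  have chi1 : (chi_mac (private_good pnc) <= 1)%N.
    apply: chi_le => //; exists (fun=> 1%N); split=> // -[u [s [u2 _]]].
    by apply: no2; exists u.
  have d1 : (min_deg2 G <= 1)%N.
    rewrite /min_deg2 big_pred0 => [|u].
      apply/bigmax_leqP => u _; rewrite leqNgt.
      by apply/negP => u2; apply: no2; exists u.
    by apply/negP => u2; apply: no2; exists u.
  have -> : (min_deg2 G)./2 = 0%N by case: (min_deg2 G) d1 => [|[]].
  rewrite invr0 mulr0 powRr0 mulr1.
  have : (chi_mac (private_good pnc))%:R <= 1%:R :> R by rewrite ler_nat.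
  lra.
set Delta := max_deg G; set mu := (min_deg2 G)./2.
have [u1 u12 u1E] := min_deg2_attained u02.
have mu0 : (0 < mu)%N by rewrite /mu u1E half_gt0.
have D0 : (0 < Delta)%N by apply: leq_trans (deg_le_max u0); apply: ltnW.
have D1 : 1 <= Delta%:R :> R by rewrite ler1n.
set t : R := Delta%:R `^ _.
have t1 : 1 <= t by rewrite -(powRr0 Delta%:R) ler_powR // divr_ge0.
set y := 4 * _ * t.
have y33 : 33 * t <= y by rewrite ler_wpM2r // (le_trans _ t1).
have y0 : 0 <= y by lra.
have /andP[ky yk] := truncn_itv y0.
set k := Num.truncn y in ky yk.
have k32 : 32 * t <= k%:R by move: yk; rewrite -natr1; lra.
have k0 : (0 < k)%N by rewrite -(ltr_nat R); lra.
apply: le_trans ky; rewrite ler_nat; apply: chi_le => //.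
apply: colorable_of_card => // u u2.
have mu_u : (mu <= (deg u)./2)%N by apply/half_leq/min_deg2_le.
set m := (deg u)./2 in mu_u *; have m0 := leq_trans mu0 mu_u.
(* The exponent 4 m / mu is at least 4, which more than covers the factor [Delta ^ 3]. *)
have tm : Delta%:R ^+ 4 <= t ^+ m :> R.
  rewrite -!powR_mulrn // -?powRrM ?ler_powR ?powR_ge0 //.
  by rewrite mulrAC ler_pdivlMr ?ltr0n // ler_wpM2l // ler_nat.
have dm : (deg u <= m.*2.+1)%N.
  by rewrite -[leqLHS]odd_double_half -add1n leq_add2r; case: odd.
rewrite -(ler_nat R).
apply: le_trans (_ : (32 * t) ^+ m <= _); last first.
  by rewrite natrX lerXn2r // ?nnegrE; lra.
rewrite exprMn.
apply: le_trans (_ : 32 ^+ m * Delta%:R ^+ 4 <= _); last first.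
  by rewrite ler_wpM2l // exprn_ge0.
rewrite -!natrX -natrM ler_nat.
apply: leq_trans (_ : 4 * Delta ^ 4 * 2 ^ m.*2.+1 <= _)%N.
  by apply: leq_mul; [apply: leq_mul|]; rewrite ?leq_pexp2l.
rewrite mulnAC leq_mul2r; apply/orP; right.
(* As m >= 1, 32^m = 8^m * 4^m >= 8 * 4^m = 4 * 2^(2m+1). *)
rewrite -(prednK m0) doubleS !expnS -mul2n expnM !mulnA leq_mul2l /=.
by rewrite (expnMn 4 8) leq_pmulr // expn_gt0.
Qed.
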